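(* Let $n\ge p$ and $l\ge 1$ be integers and let $\mathrm{St}(n,p,l)=\{\mathcal X\in\mathbb R^{n\times p\times l}:\mathcal X^\top*\mathcal X=\mathcal I\}$. Then $\mathrm{St}(n,p,l)$ is an embedded submanifold of $\mathbb R^{n\times p\times l}$ of dimension $$\dim \mathrm{St}(n,p,l)=p\Big(nl-\frac{pl}{2}-\frac{1}{2^{|\sin(l\pi/2)|}}\Big).$$
   Context: For $\mathcal A\in\mathbb R^{n\times p\times l}$, $A^{(i)}=\mathcal A(:,:,i)$ ($i=1,\dots,l$) are its frontal slices. $\operatorname{bcirc}(\mathcal A)\in\mathbb R^{nl\times pl}$ is the block circulant matrix whose $(i,j)$ block is $A^{(((i-j)\bmod l)+1)}$; $\operatorname{unfold}(\mathcal A)\in\mathbb R^{nl\times p}$ stacks $A^{(1)},\dots,A^{(l)}$ vertically and $\operatorname{fold}$ is its inverse. The t-product of $\mathcal A\in\mathbb R^{n\times p\times l}$ and $\mathcal B\in\mathbb R^{p\times m\times l}$ is $\mathcal A*\mathcal B=\operatorname{fold}(\operatorname{bcirc}(\mathcal A)\operatorname{unfold}(\mathcal B))\in\mathbb R^{n\times m\times l}$. The transpose $\mathcal A^\top\in\mathbb R^{p\times n\times l}$ has frontal slices $(A^{(1)})^\top,(A^{(l)})^\top,(A^{(l-1)})^\top,\dots,(A^{(2)})^\top$ (in this order). The identity tensor $\mathcal I\in\mathbb R^{p\times p\times l}$ has first frontal slice $I_p$ and all other frontal slices zero. *)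

(* Defs.v *)
From HB Require Import structures.
From mathcomp Require Import all_boot all_order all_algebra.
From mathcomp Require Import all_classical all_reals all_analysis.
Set Implicit Arguments. Unset Strict Implicit. Unset Printing Implicit Defensive.
Import Order.TTheory GRing.Theory Num.Theory.
Import numFieldNormedType.Exports.
Local Open Scope classical_set_scope.
Local Open Scope ring_scope.

Section Defs.
Variable R : realType.

(* A tensor in R^{n x p x l} is given by its l frontal slices A^(1..l);
   frontal slice i (1-based) is [A (i-1)] (0-based index). *)
Definition tensor (n p l : nat) := 'I_l -> 'M[R]_(n, p).

Definition circ_idx (l : nat) (i j : 'I_l) : 'I_l :=
  Ordinal (ltn_pmod (i + (l - j)) (leq_ltn_trans (leq0n i) (ltn_ord i))).

(* t-product A * B = fold (bcirc A * unfold B): the k-th block row of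
   bcirc A is [A^(((k-j) mod l)+1)]_j, so the k-th frontal slice of the
   product is \sum_j A^(((k-j) mod l)+1) B^(j+1). *)
Definition tprod (n p m l : nat) (A : tensor n p l) (B : tensor p m l)
  : tensor n m l :=
  fun k => \sum_(j < l) (A (circ_idx k j) *m B j).

Definition neg_idx (l : nat) (k : 'I_l) : 'I_l :=
  Ordinal (ltn_pmod (l - k) (leq_ltn_trans (leq0n k) (ltn_ord k))).

(* transpose: slices (A^(1))^T, (A^(l))^T, ..., (A^(2))^T, i.e. the
   0-based slice k is the transpose of the 0-based slice ((-k) mod l). *)
Definition ttr (n p l : nat) (A : tensor n p l) : tensor p n l :=
  fun k => (A (neg_idx k))^T.

Definition tid (p l : nat) : tensor p p l :=
  fun k => if (val k == 0)%N then 1%:M else 0.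

Definition tstiefel (n p l : nat) : set (tensor n p l) :=
  [set X | tprod (ttr X) X = @tid p l].

(* Identification R^{n x p x l} ~ R^{n p l} (linear bijection), used to view
   sets of tensors as subsets of a Euclidean space. *)
Definition tvec (n p l : nat) (X : tensor n p l) : 'rV[R]_(l * (n * p)) :=
  mxvec (\matrix_(k < l) mxvec (X k)).

Definition iterD (N : nat) (vs : seq 'rV[R]_N) (f : 'rV[R]_N -> 'rV[R]_N) :=
  foldr (fun v g => 'D_v g) f vs.

Definition smooth_on (N : nat) (U : set 'rV[R]_N) (f : 'rV[R]_N -> 'rV[R]_N) :=
  forall (vs : seq 'rV[R]_N) (x : 'rV[R]_N), U x ->
    {for x, continuous (iterD vs f)} /\
    (forall v, derivable (iterD vs f) x v).

Definition flat_slice (N d : nat) : set 'rV[R]_N :=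
  [set y | forall i : 'I_N, (d <= i)%N -> y ord0 i = 0].

Definition embedded_submanifold (N d : nat) (S : set 'rV[R]_N) :=
  (d <= N)%N /\
  forall x, S x ->
    exists (U V : set 'rV[R]_N) (phi psi : 'rV[R]_N -> 'rV[R]_N),
      [/\ open U, U x, open V, smooth_on U phi & smooth_on V psi] /\
      [/\ phi @` U = V,
          (forall u, U u -> psi (phi u) = u),
          (forall v, V v -> phi (psi v) = v) &
          phi @` (U `&` S) = V `&` @flat_slice N d].

End Defs.

(* Main.v *)
Require Import Defs.
From HB Require Import structures.
From mathcomp Require Import all_boot all_order all_algebra.
From mathcomp Require Import perm ring zify.
From mathcomp Require Import all_classical all_reals all_analysis.
Set Implicit Arguments. Unset Strict Implicit. Unset Printing Implicit Defensive.
Import Order.TTheory GRing.Theory Num.Theory.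
Import numFieldNormedType.Exports.
Local Open Scope classical_set_scope.
Local Open Scope ring_scope.

(** The map [bcirc] turns the t-product into the matrix product, the transpose
into the transpose, and the constraint into [X^T X = 1] for block circulant [X].
Around a point [X0] of the manifold an explicit rational chart exists: the
stereographic (Cayley) projection [Y = (X - X0) (X0^T X + 1)^-1], with inverse
[X = X0 + 2 Y (1 - X0^T Y)^-1], turns the constraint into
[W + W^T + 2 (Y^T Y - W^T W) = 0], where [W = X0^T Y].  The polynomial shear
[Y + X0 (Y^T Y - W^T W)] is invertible and straightens this quadric into the
tangent space [{Z | X0^T Z + (X0^T Z)^T = 0}].  All these maps preserve
circulant matrices and are smooth because their entries are rational functions,
so no inverse function theorem is needed.  The codimension is the rank of
[S |-> S + S^T] on p x p x l tensors; half of this map is idempotent, so that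
its rank is a trace. *)

(** * Smoothness of rational maps *)

Section RationalFunctions.
Context {R : realType} {N : nat}.
Implicit Types (U : set 'rV[R]_N) (f g : 'rV[R]_N -> R) (x v : 'rV[R]_N).

Inductive ratfun U : ('rV[R]_N -> R) -> Prop :=
| ratfun_cst c : ratfun U (fun=> c)
| ratfun_coord i : ratfun U (fun x => x ord0 i)
| ratfunD f g : ratfun U f -> ratfun U g -> ratfun U (f \+ g)
| ratfunM f g : ratfun U f -> ratfun U g -> ratfun U (f \* g)
| ratfunV f : ratfun U f -> (forall x, U x -> f x != 0) ->
    ratfun U (fun x => (f x)^-1)
| ratfun_eq f g : (forall x, U x -> f x = g x) -> ratfun U f -> ratfun U g.

Lemma near_open_eq T (h k : 'rV[R]_N -> T) U x : open U -> U x ->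
  (forall y, U y -> h y = k y) -> \forall y \near x, h y = k y.
Proof.
by move=> oU Ux hk; apply: filterS (open_nbhs_nbhs (conj oU Ux)) => y; exact: hk.
Qed.

Lemma ratfun_continuous U f x : open U -> ratfun U f -> U x ->
  {for x, continuous f}.
Proof.
move=> oU rf Ux; elim: {f} rf => [c|i|f g _ cf _ cg|f g _ cf _ cg|f _ cf f0|f g fg _ cf].
- exact: cst_continuous.
- exact: coord_continuous.
- exact: (continuousD cf cg).
- exact: (continuousM cf cg).
- by apply: continuousV => //; exact: f0.
- rewrite /prop_for /continuous_at -(fg _ Ux).
  exact: cvg_trans (near_eq_cvg (near_open_eq oU Ux fg)) cf.
Qed.

Lemma ratfun_derivable U f x v : open U -> ratfun U f -> U x -> derivable f x v.
Proof.
move=> oU rf Ux; elim: {f} rf => [c|i|f g _ df _ dg|f g _ df _ dg|f _ df f0|f g fg _ df].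
- exact: derivable_cst.
- exact/diff_derivable/differentiable_coord.
- exact: derivableD.
- exact: derivableM.
- by apply: derivableV => //; exact: f0.
- exact: near_eq_derivable (near_open_eq oU Ux fg) df.
Qed.

Lemma derive_coord i x v : 'D_v (fun y : 'rV[R]_N => y ord0 i) x = v ord0 i.
Proof.
have := @derive_mx R _ 1 N id x v (@derivable_id _ _ _ _).
by rewrite derive_id => /matrixP/(_ ord0 i); rewrite mxE.
Qed.

(** Each constructor has a differentiation rule that stays within the class. Iterating this gives
    derivatives of every order, all continuous and derivable. *)
Lemma ratfun_derive U f v : open U -> ratfun U f -> ratfun U ('D_v f).
Proof.
move=> oU; elim=> {f} [c|i|f g rf df rg dg|f g rf df rg dg|f rf df f0|f g fg rf df].
- by apply: ratfun_eq (ratfun_cst U 0) => x _; rewrite derive_cst.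
- by apply: ratfun_eq (ratfun_cst U (v ord0 i)) => x _; rewrite derive_coord.
- apply: ratfun_eq (ratfunD df dg) => x Ux.
  by rewrite deriveD//; exact: ratfun_derivable Ux.
- apply: ratfun_eq (ratfunD (ratfunM rf dg) (ratfunM rg df)) => x Ux.
  by rewrite deriveM//; exact: ratfun_derivable Ux.
- have rV := ratfunV rf f0.
  apply: ratfun_eq (ratfunM (ratfunM (ratfun_cst U (-1)) (ratfunM rV rV)) df).
  move=> x Ux; rewrite /= deriveV ?f0//; last exact: ratfun_derivable Ux.
  by rewrite mulN1r -invfM -expr2.
- apply: ratfun_eq df => x Ux.
  exact: near_eq_derive (near_open_eq oU Ux fg).
Qed.

Lemma ratfun_sum U (I : Type) (r : seq I) (P : pred I) (F : I -> 'rV[R]_N -> R) :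
  (forall i, ratfun U (F i)) -> ratfun U (fun x => \sum_(i <- r | P i) F i x).
Proof.
move=> rF; elim: r => [|i r IH].
  by apply: ratfun_eq (ratfun_cst U 0) => x _; rewrite big_nil.
case: (boolP (P i)) => Pi.
  by apply: ratfun_eq (ratfunD (rF i) IH) => x _; rewrite big_cons Pi.
by apply: ratfun_eq IH => x _; rewrite big_cons (negPf Pi).
Qed.

Lemma ratfun_prod U (I : Type) (r : seq I) (F : I -> 'rV[R]_N -> R) :
  (forall i, ratfun U (F i)) -> ratfun U (fun x => \prod_(i <- r) F i x).
Proof.
move=> rF; elim: r => [|i r IH].
  by apply: ratfun_eq (ratfun_cst U 1) => x _; rewrite big_nil.
by apply: ratfun_eq (ratfunM (rF i) IH) => x _; rewrite big_cons.
Qed.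

Definition ratmx U m n (F : 'rV[R]_N -> 'M[R]_(m, n)) :=
  forall i j, ratfun U (fun x => F x i j).

Lemma ratmx_cst U m n (A : 'M[R]_(m, n)) : ratmx U (fun=> A).
Proof. by move=> i j; exact: ratfun_cst. Qed.

Lemma ratmx_id U : ratmx U id.
Proof. by move=> i j; rewrite ord1; exact: ratfun_coord. Qed.

Lemma ratmxD U m n (F G : 'rV[R]_N -> 'M[R]_(m, n)) :
  ratmx U F -> ratmx U G -> ratmx U (fun x => F x + G x).
Proof.
by move=> rF rG i j; apply: ratfun_eq (ratfunD (rF i j) (rG i j)) => x _; rewrite mxE.
Qed.

Lemma ratmxM U m n k (F : 'rV[R]_N -> 'M[R]_(m, n)) (G : 'rV[R]_N -> 'M[R]_(n, k)) :
  ratmx U F -> ratmx U G -> ratmx U (fun x => F x *m G x).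
Proof.
move=> rF rG i j.
have rS : ratfun U (fun x => \sum_(h < n) F x i h * G x h j).
  by apply: ratfun_sum => h; exact: ratfunM.
by apply: ratfun_eq rS => x _; rewrite mxE.
Qed.

Lemma ratmx_tr U m n (F : 'rV[R]_N -> 'M[R]_(m, n)) :
  ratmx U F -> ratmx U (fun x => (F x)^T).
Proof. by move=> rF i j; apply: ratfun_eq (rF j i) => x _; rewrite mxE. Qed.

Lemma ratmxN U m n (F : 'rV[R]_N -> 'M[R]_(m, n)) :
  ratmx U F -> ratmx U (fun x => - F x).
Proof.
move=> rF i j; apply: ratfun_eq (ratfunM (ratfun_cst U (-1)) (rF i j)) => x _.
by rewrite mxE/= mulN1r.
Qed.

Lemma ratmxB U m n (F G : 'rV[R]_N -> 'M[R]_(m, n)) :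
  ratmx U F -> ratmx U G -> ratmx U (fun x => F x - G x).
Proof. by move=> rF rG; apply: ratmxD => //; exact: ratmxN. Qed.

Lemma ratfun_det U n (F : 'rV[R]_N -> 'M[R]_n) :
  ratmx U F -> ratfun U (fun x => \det (F x)).
Proof.
move=> rF; apply: ratfun_sum => s; apply: ratfunM; first exact: ratfun_cst.
by apply: ratfun_prod => i; exact: rF.
Qed.

(** Cramer's rule: the entries are cofactors over the determinant, which has no zero on [U]. *)
Lemma ratmx_inv U n (F : 'rV[R]_N -> 'M[R]_n) : ratmx U F ->
  (forall x, U x -> F x \in unitmx) -> ratmx U (fun x => invmx (F x)).
Proof.
move=> rF uF i j.
have rV : ratfun U (fun x => (\det (F x))^-1).
  apply: ratfunV; first exact: ratfun_det.
  by move=> x /uF; rewrite unitmxE unitfE.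
have rC : ratfun U (fun x => cofactor (F x) j i).
  apply: ratfunM; first exact: ratfun_cst.
  by apply: ratfun_det => a b; apply: ratfun_eq (rF _ _) => x _; rewrite !mxE.
by apply: ratfun_eq (ratfunM rV rC) => x Ux; rewrite /invmx uF// !mxE.
Qed.

(** A neighbourhood of a matrix contains a box of neighbourhoods of its finitely many entries. *)
Lemma ratmx_continuous U m n (F : 'rV[R]_N -> 'M[R]_(m, n)) x :
  open U -> ratmx U F -> U x -> {for x, continuous F}.
Proof.
move=> oU rF Ux A [P nP sPA].
have nF i j : nbhs x [set y | P i j (F y i j)].
  exact: (ratfun_continuous oU (rF i j) Ux (nP i j)).
have : nbhs x [set y | forall i j, P i j (F y i j)].
  have FF : Filter (nbhs x) by exact: nbhs_filter.
  apply: (@filter_forall _ _ (fun i => [set y | forall j, P i j (F y i j)])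
    (nbhs x) FF) => i.
  by apply: (@filter_forall _ _ (fun j => [set y | P i j (F y i j)])
    (nbhs x) FF) => j; exact: nF.
by apply: filterS => y Py; exact: sPA.
Qed.

Lemma open_unitmx n (F : 'rV[R]_N -> 'M[R]_n) :
  ratmx setT F -> open [set x | F x \in unitmx].
Proof.
move=> rF.
rewrite (_ : mkset _ = (fun x => \det (F x)) @^-1` [set r | r != 0]); last first.
  by apply/seteqP; split=> x /=; rewrite unitmxE unitfE.
apply: open_comp; last exact: open_neq.
by move=> x _; exact: (ratfun_continuous openT (ratfun_det rF) I).
Qed.

Lemma ratmx_derive U m n (F : 'rV[R]_N -> 'M[R]_(m, n)) v :
  open U -> ratmx U F -> ratmx U ('D_v F).
Proof.
move=> oU rF i j; apply: ratfun_eq (ratfun_derive v oU (rF i j)) => x Ux.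
rewrite derive_mx ?mxE//; apply/derivable_mxP => a b.
exact: ratfun_derivable (rF a b) Ux.
Qed.

Lemma ratmx_smooth U (F : 'rV[R]_N -> 'rV[R]_N) :
  open U -> ratmx U F -> smooth_on U F.
Proof.
move=> oU rF vs x Ux.
have rD : ratmx U (Defs.iterD vs F) by elim: vs => //= v vs; exact: ratmx_derive.
split; first exact: ratmx_continuous Ux.
by move=> v; apply/derivable_mxP => i j; exact: ratfun_derivable Ux.
Qed.

End RationalFunctions.

(** * The chart for matrices *)

Lemma scaler_half (R : numFieldType) (V : lmodType R) (u : V) :
  2^-1 *: u + 2^-1 *: u = u.
Proof. by rewrite -scalerDl -[2^-1]mul1r -splitr scale1r. Qed.

(** In the factorization of [K] through [pid_mx (\rank K)] the outer factors are invertible, so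
    [y *m K = 0] says that the first [\rank K] coordinates of [y *m col_ebase K] vanish. *)
Lemma flatten_kernel (R : realType) N M (K : 'M[R]_(N, M)) :
  exists2 P : 'M[R]_N, P \in unitmx &
  forall y : 'rV[R]_N, y *m K = 0 <-> flat_slice (N - \rank K) (y *m P).
Proof.
(* [flat_slice] asks the last coordinates to vanish, hence the reversal of their order. *)
pose s : {perm 'I_N} := perm (@rev_ord_inj N).
exists (col_ebase K *m perm_mx s^-1).
  by rewrite unitmx_mul col_ebase_unit unitmx_perm.
move=> y; rewrite -{1}(mulmx_ebase K) !mulmxA; move: (y *m col_ebase K) => u.
have rN : (\rank K <= N)%N := rank_leq_row K.
have rM : (\rank K <= M)%N := rank_leq_col K.
have uP i : (u *m perm_mx s^-1) ord0 i = u ord0 (rev_ord i).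
  by rewrite -col_permE mxE permE.
transitivity (forall i : 'I_N, (i < \rank K)%N -> u ord0 i = 0).
  transitivity (u *m pid_mx (\rank K) = 0 :> 'rV[R]_M).
    split=> [|->]; last by rewrite mul0mx.
    by move/(congr1 (mulmx^~ (invmx (row_ebase K))));
      rewrite mulmxK ?row_ebase_unit// mul0mx.
  have uE i (lt : (i < \rank K)%N) (iN : (i < N)%N) (iM : (i < M)%N) :
      (u *m (pid_mx (\rank K) : 'M[R]_(N, M))) ord0 (Ordinal iM) = u ord0 (Ordinal iN).
    rewrite mxE (bigD1 (Ordinal iN)) //= mxE /= eqxx lt mulr1.
    have -> : \sum_(j < N | j != Ordinal iN) u ord0 j *
        (pid_mx (\rank K) : 'M[R]_(N, M)) j (Ordinal iM) = 0; last by rewrite addr0.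
    apply: big1 => j ji; rewrite mxE /=.
    by have -> : (j == i :> nat) = false by [exact: negPf ji]; rewrite mulr0.
  split=> [u0 [i iN] /= lt|u0].
    by rewrite -(uE _ lt iN (leq_trans lt rM)) u0 mxE.
  apply/rowP => -[i iM]; rewrite [RHS]mxE.
  have [lt|ge] := ltnP i (\rank K).
    by rewrite (uE _ lt (leq_trans lt rN)) u0.
  rewrite mxE big1// => j _; rewrite mxE /=.
  by have [->|_] := eqVneq (j : nat) i; rewrite ?(ltnNge i) ?ge mulr0.
split=> [u0 i di|u0 i ir].
  rewrite uP u0//=; have := ltn_ord i; move: di rN; lia.
rewrite -[i]rev_ordK -uP u0//=; have := ltn_ord i; lia.
Qed.

(** Write [P = C *m B] as a full rank factorization. Cancelling [C] on the left and [B] on the right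
    in [C B C B = C B] leaves [B *m C = 1%:M], whose size is the rank and whose trace is that of
    [P]. *)
Lemma idempotent_rank (F : fieldType) n (P : 'M[F]_n) :
  P *m P = P -> (\rank P)%:R = \tr P.
Proof.
move=> PP.
move: (col_base P) (row_base P) (mulmx_base P) (row_base_free P) (col_base_full P).
move=> C B CB Bfree Cfull; have BC : B *m C = 1%:M.
  apply: (row_free_inj Bfree); apply: (row_full_inj Cfull).
  by rewrite /= mul1mx -mulmxA [C *m _]mulmxA CB PP.
by rewrite -[in RHS]CB mxtrace_mulC BC mxtrace1.
Qed.

(** * The Cayley transform and the shear *)

Section Chart.
Context {R : numFieldType} {m q : nat} (X0 : 'M[R]_(m, q)).
Hypothesis X0o : X0^T *m X0 = 1%:M.

(** For real vectors ([q = 1]) on the unit sphere, the component of the image orthogonal to [X0] is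
    the stereographic projection from the pole [- X0]; the sphere without this pole becomes a
    paraboloid. *)
Definition stereo (X : 'M[R]_(m, q)) := (X - X0) *m invmx (X0^T *m X + 1%:M).

(** This solves [Y *m (X0^T *m X + 1%:M) = X - X0] for [X], since the bracket equals twice the
    inverse of [1%:M - X0^T *m Y]. *)
Definition stereo_inv (Y : 'M[R]_(m, q)) :=
  X0 + (Y *m invmx (1%:M - X0^T *m Y) + Y *m invmx (1%:M - X0^T *m Y)).

(** This is [Y^T *m (1%:M - X0 *m X0^T) *m Y], the Gram matrix of the component of [Y] orthogonal to
    the columns of [X0]. *)
Definition normal_gram (Y : 'M[R]_(m, q)) :=
  Y^T *m Y - (X0^T *m Y)^T *m (X0^T *m Y).

Definition shear (Y : 'M[R]_(m, q)) := Y + X0 *m normal_gram Y.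
Definition unshear (Y : 'M[R]_(m, q)) := Y - X0 *m normal_gram Y.

Let invmx_double (n : nat) (A B : 'M[R]_n) : A \in unitmx -> B = invmx A + invmx A ->
  B \in unitmx /\ invmx B = 2^-1 *: A.
Proof.
move=> Au ->; rewrite -mulr2n -scaler_nat; split.
  by rewrite unitmxZ ?unitmx_inv// unitfE pnatr_eq0.
by rewrite invmxZ ?unitmxZ ?unitmx_inv ?unitfE ?pnatr_eq0 // invmxK.
Qed.

(** With [C = X0^T *m X], the product [X0^T *m stereo X] is [(C - 1)(C + 1)^-1 = 1 - 2 (C + 1)^-1].
    So the denominators of the two maps are inverse to each other up to the factor 2. *)
Lemma stereo_unit X : X0^T *m X + 1%:M \in unitmx ->
  1%:M - X0^T *m stereo X \in unitmx /\
  invmx (1%:M - X0^T *m stereo X) = 2^-1 *: (X0^T *m X + 1%:M).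
Proof.
move=> u; apply: invmx_double => //.
rewrite /stereo mulmxA mulmxBr X0o.
have -> : X0^T *m X - 1%:M = (X0^T *m X + 1%:M) - (1%:M + 1%:M).
  by rewrite opprD addrA addrK.
by rewrite mulmxBl mulmxV// mulmxDl mul1mx opprB addrCA subrr addr0.
Qed.

Lemma stereo_inv_unit Y : 1%:M - X0^T *m Y \in unitmx ->
  X0^T *m stereo_inv Y + 1%:M \in unitmx /\
  invmx (X0^T *m stereo_inv Y + 1%:M) = 2^-1 *: (1%:M - X0^T *m Y).
Proof.
move=> u; apply: invmx_double => //.
rewrite /stereo_inv !mulmxDr X0o mulmxA.
set H := 1%:M - X0^T *m Y in u *.
have -> : X0^T *m Y = 1%:M - H by rewrite /H opprB addrCA subrr addr0.
rewrite mulmxBl mulmxV// mul1mx.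
by apply/matrixP => i j; rewrite !mxE; ring.
Qed.

Lemma stereoK X : X0^T *m X + 1%:M \in unitmx -> stereo_inv (stereo X) = X.
Proof.
move=> u; have [_ e] := stereo_unit u; rewrite /stereo_inv e -scalemxAr scaler_half.
by rewrite /stereo mulmxKV// addrC subrK.
Qed.

Lemma stereo_invK Y : 1%:M - X0^T *m Y \in unitmx -> stereo (stereo_inv Y) = Y.
Proof.
move=> u; have [_ e] := stereo_inv_unit u.
rewrite /stereo e /stereo_inv addrAC subrr add0r.
by rewrite -scalemxAr mulmxDl mulmxKV// scalerDr scaler_half.
Qed.

Lemma tr_normal_gram Y : (normal_gram Y)^T = normal_gram Y.
Proof. by rewrite /normal_gram raddfB /= !trmx_mul !trmxK. Qed.

(** Adding [X0 *m S] leaves the component orthogonal to [X0] unchanged. Hence the shear does not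
    alter its own correction term and is undone by a change of sign. *)
Lemma normal_gram_shift Y S : normal_gram (Y + X0 *m S) = normal_gram Y.
Proof.
have e1 : X0^T *m (Y + X0 *m S) = X0^T *m Y + S by rewrite mulmxDr mulmxA X0o mul1mx.
rewrite /normal_gram e1 !raddfD /= !mulmxDl ?mulmxDr !trmx_mul !trmxK.
have -> : S^T *m X0^T *m (X0 *m S) = S^T *m S.
  by rewrite -mulmxA [X0^T *m _]mulmxA X0o mul1mx.
rewrite !mulmxA.
set a := Y^T *m Y; set b := Y^T *m X0 *m S; set c := S^T *m X0^T *m Y.
set d := S^T *m S; set e := Y^T *m X0 *m X0^T *m Y.
by apply/matrixP => i j; rewrite !mxE; ring.
Qed.

Lemma shearK Y : unshear (shear Y) = Y.
Proof. by rewrite /unshear {2}/shear normal_gram_shift /shear addrK. Qed.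

Lemma unshearK Y : shear (unshear Y) = Y.
Proof. by rewrite /shear {2}/unshear -mulmxN normal_gram_shift /unshear subrK. Qed.

Lemma stiefel_shear_stereo X : X0^T *m X + 1%:M \in unitmx ->
  X^T *m X = 1%:M <->
  X0^T *m shear (stereo X) + (X0^T *m shear (stereo X))^T = 0.
Proof.
move=> u; have [uH _] := stereo_unit u.
rewrite -{1 2}(stereoK u); move: (stereo X) uH => Y uH.
set W := X0^T *m Y in uH.
have [H eH] : exists H, H = 1%:M - W by exists (1%:M - W).
have [D DH eX] : exists2 D, D *m H = Y & stereo_inv Y = X0 + (D + D).
  by exists (Y *m invmx H); rewrite eH // mulmxKV.
rewrite -eH in uH; rewrite eX.
(* Here [X = X0 + 2 D] with [D *m H = Y], so the congruence by [H] clears all denominators and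
   leaves a quadratic expression in [Y]. *)
have key : H^T *m ((X0 + (D + D))^T *m (X0 + (D + D)) - 1%:M) *m H =
    2 *: (X0^T *m shear Y + (X0^T *m shear Y)^T).
  have -> : (X0 + (D + D))^T *m (X0 + (D + D)) - 1%:M =
      (X0^T *m D + D^T *m X0 + (D^T *m D + D^T *m D)) +
      (X0^T *m D + D^T *m X0 + (D^T *m D + D^T *m D)).
    rewrite !raddfD /= !mulmxDl ?mulmxDr X0o.
    set a := X0^T *m D; set b := D^T *m X0; set c := D^T *m D.
    by apply/matrixP => i j; rewrite !mxE; ring.
  have -> : X0^T *m shear Y = W + normal_gram Y.
    by rewrite /shear mulmxDr mulmxA X0o mul1mx.
  rewrite [(W + _)^T]raddfD /= tr_normal_gram.
  rewrite !mulmxDr !mulmxDl.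
  have -> : H^T *m (X0^T *m D) *m H = H^T *m W.
    by rewrite -!mulmxA DH.
  have -> : H^T *m (D^T *m X0) *m H = W^T *m H.
    by rewrite mulmxA -trmx_mul DH /W [(X0^T *m Y)^T]trmx_mul trmxK.
  have -> : H^T *m (D^T *m D) *m H = Y^T *m Y.
    by rewrite mulmxA -trmx_mul DH -mulmxA DH.
  rewrite /normal_gram -/W eH [(1%:M - _)^T]raddfB /= trmx1 mulmxBl mulmxBr mul1mx mulmx1.
  set a := Y^T *m Y; set b := W^T *m W; set c := W^T.
  by apply/matrixP => i j; rewrite !mxE; ring.
(* One direction cancels the scalar 2, the other the invertible factors [H^T] and [H]. *)
split=> [e|e].
  move: key; rewrite e subrr mulmx0 mul0mx => /esym/eqP.
  by rewrite scaler_eq0 pnatr_eq0 /= => /eqP.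
move: key; rewrite e scaler0 => /(congr1 (fun A => invmx H^T *m A *m invmx H)).
rewrite mulmx0 mul0mx mulmxA mulmxK// mulKmx ?unitmx_tr// => /eqP.
by rewrite subr_eq0 => /eqP.
Qed.

End Chart.

(** * Block circulant matrices *)

Section Circulant.
Context {R : realType} {l' : nat}.
Local Notation l := l'.+1.
Local Notation bdim n := (\sum_(i < l) n)%N.
Implicit Types (n p m : nat) (i j k : 'I_l).

Lemma circ_idxE i j : circ_idx i j = i - j.
Proof. by apply: val_inj => /=; rewrite modnDmr. Qed.

Lemma neg_idxE k : neg_idx k = - k.
Proof. by apply: val_inj. Qed.

(** The size [l'.+1] gives ['I_l] the additive group of integers modulo [l], where the circulant
    index is a plain difference. *)
Definition bcirc n p (X : tensor R n p l) : 'M[R]_(bdim n, bdim p) :=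
  \mxblock_(i, j) X (i - j).

Definition slices n p (M : 'M[R]_(bdim n, bdim p)) : tensor R n p l :=
  fun k => submxblock M k 0.

(** This is a simultaneous cyclic shift of block rows and block columns. Circulant matrices are its
    fixed points, so their closure properties follow from its compatibility with the matrix
    operations. *)
Definition bshift n p k (M : 'M[R]_(bdim n, bdim p)) : 'M[R]_(bdim n, bdim p) :=
  \mxblock_(i, j) submxblock M (i + k) (j + k).

Definition circulant n p (M : 'M[R]_(bdim n, bdim p)) := forall k, bshift k M = M.

Lemma bcircK n p (X : tensor R n p l) : slices (bcirc X) = X.
Proof. by apply/funext => k; rewrite /slices mxblockK subr0. Qed.

Lemma bcirc_inj n p : injective (@bcirc n p).
Proof. exact: can_inj (@bcircK n p). Qed.

Lemma bcirc_circulant n p (X : tensor R n p l) : circulant (bcirc X).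
Proof.
move=> k; apply: eq_mxblock => i j; rewrite mxblockK.
by rewrite opprD addrACA subrr addr0.
Qed.

(** Shifting by [- j] moves block [(i, j)] to [(i - j, 0)], so the first block column determines a
    circulant matrix. *)
Lemma slicesK n p (M : 'M[R]_(bdim n, bdim p)) : circulant M -> bcirc (slices M) = M.
Proof.
move=> cM; apply/mxblockP => i j; rewrite mxblockK /slices.
by rewrite -{2}(cM (- j)) mxblockK subrr.
Qed.

Lemma submxblockM n p m (A : 'M[R]_(bdim n, bdim p)) (B : 'M[R]_(bdim p, bdim m)) i j :
  submxblock (A *m B) i j = \sum_k submxblock A i k *m submxblock B k j.
Proof. by rewrite -{1}(submxblockK A) -{1}(submxblockK B) mul_mxblock mxblockK. Qed.

Lemma bshiftM n p m k (A : 'M[R]_(bdim n, bdim p)) (B : 'M[R]_(bdim p, bdim m)) :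
  bshift k (A *m B) = bshift k A *m bshift k B.
Proof.
rewrite mul_mxblock; apply: eq_mxblock => i j.
by rewrite submxblockM (reindex_inj (addIr k)).
Qed.

Lemma circulantM n p m (A : 'M[R]_(bdim n, bdim p)) (B : 'M[R]_(bdim p, bdim m)) :
  circulant A -> circulant B -> circulant (A *m B).
Proof. by move=> cA cB k; rewrite bshiftM cA cB. Qed.

Lemma circulant_tr n p (A : 'M[R]_(bdim n, bdim p)) : circulant A -> circulant A^T.
Proof.
move=> cA k; rewrite -{2}(cA k) tr_mxblock; apply: eq_mxblock => i j.
by rewrite -{1}(submxblockK A) tr_mxblock mxblockK.
Qed.

Lemma circulantD n p (A B : 'M[R]_(bdim n, bdim p)) :
  circulant A -> circulant B -> circulant (A + B).
Proof.
move=> cA cB k; rewrite -{2}(cA k) -{2}(cB k) -mxblockD.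
by apply: eq_mxblock => i j; rewrite submxblockD.
Qed.

Lemma circulantN n p (A : 'M[R]_(bdim n, bdim p)) : circulant A -> circulant (- A).
Proof.
move=> cA k; rewrite -{2}(cA k) -mxblockN.
by apply: eq_mxblock => i j; rewrite submxblockN.
Qed.

Lemma circulantB n p (A B : 'M[R]_(bdim n, bdim p)) :
  circulant A -> circulant B -> circulant (A - B).
Proof. by move=> cA cB; apply: circulantD => //; exact: circulantN. Qed.

Lemma bcirc_tid p : bcirc (@tid R p l) = 1%:M.
Proof.
rewrite -(@mxdiagZ R l (fun=> p) 1).
apply: eq_mxblock => i j; rewrite /tid.
have -> : (val (i - j : 'I_l) == 0%N) = (i == j) by rewrite -subr_eq0.
by case: (i == j); rewrite ?conform_mx_id.
Qed.

Lemma circulant1 p : circulant (1%:M : 'M[R]_(bdim p)).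
Proof. by rewrite -bcirc_tid; exact: bcirc_circulant. Qed.

(** The shift of [invmx A] is again a right inverse of [A], because the shift is multiplicative and
    fixes [A] and [1%:M]. *)
Lemma circulantV p (A : 'M[R]_(bdim p)) : A \in unitmx -> circulant A ->
  circulant (invmx A).
Proof.
move=> uA cA k; apply: (can_inj (mulKmx uA)).
by rewrite -{1}(cA k) -bshiftM !mulmxV ?circulant1.
Qed.

Lemma bcirc_tr n p (X : tensor R n p l) : bcirc (ttr X) = (bcirc X)^T.
Proof.
rewrite tr_mxblock; apply: eq_mxblock => i j.
by rewrite /ttr neg_idxE opprB.
Qed.

(** Both sides are a convolution over the integers modulo [l]; translating the summation index by
    [j] matches them. *)
Lemma bcirc_tprod n p m (A : tensor R n p l) (B : tensor R p m l) :
  bcirc (tprod A B) = bcirc A *m bcirc B.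
Proof.
rewrite mul_mxblock; apply: eq_mxblock => i j.
rewrite /tprod [RHS](reindex_inj (addIr j)); apply: eq_bigr => k _.
by rewrite circ_idxE addrK opprD addrA addrAC.
Qed.

Lemma tstiefelP n p (X : tensor R n p l) :
  tstiefel X <-> (bcirc X)^T *m bcirc X = 1%:M.
Proof.
rewrite -bcirc_tr -bcirc_tprod -bcirc_tid.
by split=> [->//|/bcirc_inj].
Qed.

(** * Coordinates of tensors and of circulant matrices *)

Definition tunvec n p (x : 'rV[R]_(l * (n * p))) : tensor R n p l :=
  fun k => vec_mx (row k (vec_mx x)).

Lemma tunvecK n p : cancel (@tunvec n p) (@tvec R n p l).
Proof.
move=> x; rewrite /tvec -[RHS]vec_mxK; congr mxvec.
by apply/row_matrixP => k; rewrite rowK vec_mxK.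
Qed.

Lemma tvecK n p : cancel (@tvec R n p l) (@tunvec n p).
Proof. by move=> X; apply/funext => k; rewrite /tunvec mxvecK rowK mxvecK. Qed.

Lemma tunvecE n p (x : 'rV[R]_(l * (n * p))) k a b :
  tunvec x k a b = x ord0 (mxvec_index k (mxvec_index a b)).
Proof. by rewrite !mxE. Qed.

Lemma tvecE n p (X : tensor R n p l) k a b :
  tvec X ord0 (mxvec_index k (mxvec_index a b)) = X k a b.
Proof. by rewrite mxvecE mxE mxvecE. Qed.

(** [vcirc] identifies the coordinate space with the circulant matrices. [unvcirc] reads the first
    block column of any matrix, so it inverts [vcirc] on the left always, on the right only for
    circulant matrices. *)
Definition vcirc n p (x : 'rV[R]_(l * (n * p))) := bcirc (tunvec x).
Definition unvcirc n p (M : 'M[R]_(bdim n, bdim p)) := tvec (slices M).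

Lemma vcircK n p : cancel (@vcirc n p) (@unvcirc n p).
Proof. by move=> x; rewrite /unvcirc bcircK tunvecK. Qed.

Lemma unvcircK n p (M : 'M[R]_(bdim n, bdim p)) : circulant M ->
  vcirc (unvcirc M) = M.
Proof. by move=> cM; rewrite /vcirc tvecK slicesK. Qed.

Lemma vcirc_circulant n p (x : 'rV[R]_(l * (n * p))) : circulant (vcirc x).
Proof. exact: bcirc_circulant. Qed.

Lemma image_tstiefelP n p (x : 'rV[R]_(l * (n * p))) :
  (@tvec R n p l @` @tstiefel R n p l) x <-> (vcirc x)^T *m vcirc x = 1%:M.
Proof.
split=> [[X sX <-]|sx]; first by rewrite /vcirc tvecK; exact/tstiefelP.
by exists (tunvec x); [exact/tstiefelP|rewrite tunvecK].
Qed.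

Lemma vcirc_is_linear n p : linear (@vcirc n p).
Proof.
move=> a x y; by apply/matrixP => s t; rewrite /vcirc /bcirc /tunvec !mxE.
Qed.

Lemma unvcirc_is_linear n p : linear (@unvcirc n p).
Proof.
move=> a x y; apply/rowP => s; case/mxvec_indexP: s => k ab.
by case/mxvec_indexP: ab => u v; rewrite !mxE !tvecE !mxE.
Qed.

Lemma vcirc_rat N (U : set 'rV[R]_N) n p (F : 'rV[R]_N -> 'rV[R]_(l * (n * p))) :
  ratmx U F -> ratmx U (fun x => vcirc (F x)).
Proof.
move=> rF s t; apply: ratfun_eq (rF ord0 _) => x _.
rewrite mxE tunvecE //.
Qed.

Lemma unvcirc_rat N (U : set 'rV[R]_N) n p (F : 'rV[R]_N -> 'M[R]_(bdim n, bdim p)) :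
  ratmx U F -> ratmx U (fun x => unvcirc (F x)).
Proof.
move=> rF i s; rewrite ord1; case/mxvec_indexP: s => k ab.
case/mxvec_indexP: ab => u v; apply: ratfun_eq (rF _ _) => x _.
by rewrite tvecE mxE.
Qed.

End Circulant.

(** * The dimension *)

Section Dimension.
Context {R : realType} {l' : nat}.
Local Notation l := l'.+1.
Local Notation bdim n := (\sum_(i < l) n)%N.

HB.instance Definition _ n p := GRing.isLinear.Build R _ _ _
  (@vcirc R l' n p) (@vcirc_is_linear R l' n p).
HB.instance Definition _ n p := GRing.isLinear.Build R _ _ _
  (@unvcirc R l' n p) (@unvcirc_is_linear R l' n p).

(** In coordinates, [S + S^T] is the differential of [X^T X] at a point [X0] of the manifold in the
    direction [X0 S], so its rank is the codimension. *)
Definition tsym p (s : 'rV[R]_(l * (p * p))) := unvcirc (vcirc s + (vcirc s)^T).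

Lemma tsym_is_linear p : linear (@tsym p).
Proof.
move=> a x y; rewrite /tsym -linearP; congr unvcirc.
by rewrite !linearP /= scalerDr addrACA.
Qed.
HB.instance Definition _ p := GRing.isLinear.Build R _ _ _ (@tsym p) (@tsym_is_linear p).

Lemma vcirc_tsym p (s : 'rV[R]_(l * (p * p))) :
  vcirc (tsym s) = vcirc s + (vcirc s)^T.
Proof.
rewrite unvcircK//; have cs := vcirc_circulant s.
by apply: circulantD => //; exact: circulant_tr.
Qed.

Lemma tsymE p (s : 'rV[R]_(l * (p * p))) k a b :
  tsym s ord0 (mxvec_index k (mxvec_index a b)) =
  s ord0 (mxvec_index k (mxvec_index a b)) +
  s ord0 (mxvec_index (- k) (mxvec_index b a)).
Proof.
rewrite /tsym raddfD /= vcircK mxE; congr (_ + _).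
by rewrite /unvcirc /vcirc -bcirc_tr bcircK tvecE mxE neg_idxE tunvecE.
Qed.

Definition symmx p : 'M[R]_(l * (p * p)) := lin1_mx (@tsym p).

Lemma symmx_square p : symmx p *m symmx p = symmx p + symmx p.
Proof.
apply/row_matrixP => i; rewrite !rowE mulmxA mulmxDr !mul_rV_lin1.
apply: (can_inj (@vcircK R l' p p)).
rewrite [RHS]raddfD /= !vcirc_tsym [(_ + _)^T]raddfD /= trmxK.
by rewrite [_^T + _]addrC.
Qed.

Lemma rank_symmx p : (\rank (symmx p))%:R = \tr (symmx p) / 2.
Proof.
have -> : \rank (symmx p) = \rank (2^-1 *: symmx p).
  by rewrite mxrank_scale_nz// invr_eq0 pnatr_eq0.
rewrite idempotent_rank ?mxtraceZ 1?mulrC//.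
by rewrite -scalemxAl -scalemxAr symmx_square scalerDr scaler_half.
Qed.

Lemma mxvec_index_eq m n (i i' : 'I_m) (j j' : 'I_n) :
  (mxvec_index i j == mxvec_index i' j') = (i == i') && (j == j').
Proof. by rewrite (inj_eq (@cast_ord_inj _ _ _)) (inj_eq enum_rank_inj) xpair_eqE. Qed.

Lemma sum_mxvec_index (V : nmodType) m n (F : 'I_(m * n) -> V) :
  \sum_i F i = \sum_a \sum_b F (mxvec_index a b).
Proof.
rewrite pair_bigA (reindex _ (curry_mxvec_bij m n)) /=.
by apply: eq_bigr => -[a b].
Qed.

(** The solutions of [2 k = 0] modulo [l] are [0] and, for even [l], also [l / 2]. *)
Lemma card_self_opp : #|[pred k : 'I_l | - k == k]| = if odd l then 1%N else 2%N.
Proof.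
have oppE (k : 'I_l) : (- k == k) = ((k == 0 :> nat) || (k + k == l :> nat))%N.
  rewrite -val_eqE /=; have kl := ltn_ord k.
  have [->|k0] := posnP k; first by rewrite subn0 modnn.
  by rewrite modn_small; lia.
case: ifP => ol.
  rewrite -(card1 (0 : 'I_l)); apply: eq_card => k; rewrite !inE oppE -val_eqE /=.
  by have := ltn_ord k; lia.
have hl : (l./2 < l)%N by lia.
pose h : 'I_l := Ordinal hl.
have h0 : (0 : 'I_l) != h by rewrite -val_eqE /=; lia.
rewrite (_ : 2%N = #|pred2 (0 : 'I_l) h|); last by rewrite card2 h0.
apply: eq_card => k; rewrite !inE oppE -!val_eqE /=.
have := ltn_ord k; lia.
Qed.

(** The coordinate [(k, a, b)] is sent to itself plus [(- k, b, a)]. Each diagonal entry is thus 1,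
    or 2 when [- k = k] and [a = b]. *)
Lemma trace_symmx p : \tr (symmx p) =
  l%:R * (p%:R * p%:R) + p%:R * (if odd l then 1 else 2) :> R.
Proof.
have diagE k a b :
    symmx p (mxvec_index k (mxvec_index a b)) (mxvec_index k (mxvec_index a b))
    = 1 + (- k == k)%:R * (a == b)%:R.
  rewrite mxE tsymE !mxE !eqxx !mxvec_index_eq /= [b == a]eq_sym.
  by rewrite andbb -natrM mulnb.
transitivity (\sum_(k < l) \sum_(a < p) \sum_(b < p)
    (1 + (- k == k)%:R * (a == b)%:R) : R).
  rewrite /mxtrace sum_mxvec_index; apply: eq_bigr => k _.
  by rewrite sum_mxvec_index; do 2!apply: eq_bigr => ? _.
have deltaE (a : 'I_p) : \sum_(b < p) (a == b)%:R = 1 :> R.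
  rewrite (bigD1 a)//= eqxx big1 ?addr0// => b.
  by rewrite eq_sym => /negPf ->.
under eq_bigr => k _.
  under eq_bigr do rewrite big_split /= -mulr_sumr deltaE sumr_const card_ord mulr1.
  rewrite big_split /= !sumr_const card_ord.
  over.
rewrite big_split /= sumr_const card_ord sumrMnl -natr_sum -big_mkcond /=.
have -> : (\sum_(k < l | - k == k) 1 = if odd l then 1 else 2)%N.
  by rewrite -card_self_opp -sum1_card.
rewrite -[_ *+ l]mulr_natl -[p%:R *+ p]mulr_natl.
rewrite -[(if _ then _ else _)%:R *+ p]mulr_natl.
by rewrite /=; case: (odd l') => /=; ring.
Qed.

(** [K] represents [y |-> S + S^T] with [S = X0^T y]. The map [y |-> X0^T y] has the right inverse
    [s |-> X0 s], so composing with it does not lower the rank of [symmx p]. *)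
Lemma tangent_matrix n p (X0 : 'M[R]_(bdim n, bdim p)) : circulant X0 ->
  X0^T *m X0 = 1%:M ->
  exists2 K : 'M[R]_(l * (n * p), l * (p * p)), \rank K = \rank (symmx p) &
  forall y, y *m K = 0 <-> X0^T *m vcirc y + (X0^T *m vcirc y)^T = 0.
Proof.
move=> cX oX; have cXt := circulant_tr cX.
pose f1 (y : 'rV[R]_(l * (n * p))) : 'rV[R]_(l * (p * p)) := unvcirc (X0^T *m vcirc y).
pose g1 (s : 'rV[R]_(l * (p * p))) : 'rV[R]_(l * (n * p)) := unvcirc (X0 *m vcirc s).
have lf : linear f1 by move=> a x y; rewrite /f1 !linearP.
have lg : linear g1 by move=> a x y; rewrite /g1 !linearP.
pose f : {linear _ -> _} := HB.pack f1 (GRing.isLinear.Build R _ _ _ f1 lf).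
pose g : {linear _ -> _} := HB.pack g1 (GRing.isLinear.Build R _ _ _ g1 lg).
have vf y : vcirc (f y) = X0^T *m vcirc y.
  by rewrite /f /= /f1 unvcircK//; apply: circulantM => //; exact: vcirc_circulant.
have vg s : vcirc (g s) = X0 *m vcirc s.
  by rewrite /g /= /g1 unvcircK//; apply: circulantM => //; exact: vcirc_circulant.
exists (lin1_mx f *m symmx p).
  apply/eqP; rewrite eqn_leq mxrankM_maxr /=.
  rewrite -[X in (\rank X <= _)%N](_ : lin1_mx g *m (lin1_mx f *m symmx p) = _).
    exact: mxrankM_maxr.
  apply/row_matrixP => i; rewrite !rowE !mulmxA !mul_rV_lin1.
  congr (tsym _); apply: (can_inj (@vcircK R l' p p)).
  by rewrite vf vg mulmxA oX mul1mx.
move=> y; rewrite mulmxA !mul_rV_lin1 /=.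
rewrite -[_ + _](_ : vcirc (tsym (f y)) = _); last by rewrite vcirc_tsym vf.
split=> [->|]; first by rewrite raddf0.
by rewrite -[in RHS](raddf0 (@vcirc R l' p p)) => /(can_inj (@vcircK R l' p p)).
Qed.

(** The sine is [0] for even [l] and has absolute value 1 for odd [l]. The result is half the number
    of [k] with [- k = k]. *)
Lemma one_div_powR_sin : 1 / (2 `^ `|sin (l%:R * pi / 2)|) =
  (if odd l then 2^-1 else 1) :> R.
Proof.
have sin_nat (k : nat) : sin (k%:R * pi) = 0 :> R.
  elim: k => [|k IH]; first by rewrite mul0r sin0.
  by rewrite -natr1 mulrDl mul1r sinD sinpi mulr0 IH mul0r addr0.
have cos_nat (k : nat) : `|cos (k%:R * pi)| = 1 :> R.
  elim: k => [|k IH]; first by rewrite mul0r cos0 normr1.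
  by rewrite -natr1 mulrDl mul1r cosD sinpi mulr0 subr0 cospi mulrN1 normrN.
rewrite -{1}(odd_double_half l); case: ifP => _.
  rewrite natrD -muln2 natrM.
  have -> : (1%:R + l./2%:R * 2%:R) * pi / 2 = pi / 2 + l./2%:R * pi :> R by field.
  by rewrite sinD sin_pihalf cos_pihalf mul0r addr0 div1r mul1r cos_nat powRr1.
rewrite add0n -muln2 natrM.
have -> : l./2%:R * 2%:R * pi / 2 = l./2%:R * pi :> R by field.
by rewrite sin_nat normr0 powRr0 divr1.
Qed.

End Dimension.

(** * The submanifold *)

Section ChartRational.
Context {R : realType} {N m q : nat} (X0 : 'M[R]_(m, q)).
Context (U : set 'rV[R]_N) (F : 'rV[R]_N -> 'M[R]_(m, q)).
Hypothesis rF : ratmx U F.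

Lemma normal_gram_rat : ratmx U (fun x => normal_gram X0 (F x)).
Proof.
have rW := ratmxM (ratmx_cst U X0^T) rF.
by apply: ratmxB; apply: ratmxM => //; exact: ratmx_tr.
Qed.

Lemma shear_rat : ratmx U (fun x => shear X0 (F x)).
Proof.
apply: ratmxD => //; apply: ratmxM; first exact: ratmx_cst.
exact: normal_gram_rat.
Qed.

Lemma unshear_rat : ratmx U (fun x => unshear X0 (F x)).
Proof.
apply: ratmxB => //; apply: ratmxM; first exact: ratmx_cst.
exact: normal_gram_rat.
Qed.

Lemma stereo_den_rat : ratmx U (fun x => X0^T *m F x + 1%:M).
Proof. by do ?[apply: ratmxD|apply: ratmxM|exact: ratmx_cst]. Qed.

Lemma stereo_inv_den_rat : ratmx U (fun x => 1%:M - X0^T *m F x).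
Proof. by do ?[apply: ratmxB|apply: ratmxM|exact: ratmx_cst]. Qed.

Lemma stereo_rat :
  (forall x, U x -> X0^T *m F x + 1%:M \in unitmx) ->
  ratmx U (fun x => stereo X0 (F x)).
Proof.
move=> uF; apply: ratmxM; first by apply: ratmxB => //; exact: ratmx_cst.
by apply: ratmx_inv => //; exact: stereo_den_rat.
Qed.

Lemma stereo_inv_rat :
  (forall x, U x -> 1%:M - X0^T *m F x \in unitmx) ->
  ratmx U (fun x => stereo_inv X0 (F x)).
Proof.
move=> uF; apply: ratmxD; first exact: ratmx_cst.
have rD : ratmx U (fun x => F x *m invmx (1%:M - X0^T *m F x)).
  by apply: ratmxM => //; apply: ratmx_inv => //; exact: stereo_inv_den_rat.
exact: ratmxD.
Qed.

End ChartRational.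

(** * The chart maps preserve circulant matrices *)

Section ChartCirculant.
Context {R : realType} {l' n p : nat}.
Local Notation bdim n := (\sum_(i < l'.+1) n)%N.
Variable X0 : 'M[R]_(bdim n, bdim p).
Hypothesis cX0 : circulant X0.
Implicit Types M : 'M[R]_(bdim n, bdim p).

Lemma circulant_normal_gram M : circulant M -> circulant (normal_gram X0 M).
Proof.
move=> cM; have cX := circulant_tr cX0; have cW := circulantM cX cM.
by apply: circulantB; apply: circulantM => //; exact: circulant_tr.
Qed.

Lemma circulant_shear M : circulant M -> circulant (shear X0 M).
Proof.
move=> cM; apply: circulantD => //; apply: circulantM => //.
exact: circulant_normal_gram.
Qed.

Lemma circulant_unshear M : circulant M -> circulant (unshear X0 M).
Proof.
move=> cM; apply: circulantB => //; apply: circulantM => //.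
exact: circulant_normal_gram.
Qed.

Lemma circulant_stereo M : X0^T *m M + 1%:M \in unitmx -> circulant M ->
  circulant (stereo X0 M).
Proof.
move=> uM cM; have cX := circulant_tr cX0.
apply: circulantM; first exact: circulantB.
apply: circulantV => //; apply: circulantD; last exact: circulant1.
exact: circulantM.
Qed.

Lemma circulant_stereo_inv M : 1%:M - X0^T *m M \in unitmx -> circulant M ->
  circulant (stereo_inv X0 M).
Proof.
move=> uM cM; have cX := circulant_tr cX0.
apply: circulantD => //.
have cD : circulant (M *m invmx (1%:M - X0^T *m M)).
  apply: circulantM => //; apply: circulantV => //.
  by apply: circulantB; [exact: circulant1|exact: circulantM].
exact: circulantD.
Qed.

End ChartCirculant.

Lemma tstiefel_submanifold (R : realType) (l' n p : nat) : (p <= n)%N ->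
  @embedded_submanifold R (l'.+1 * (n * p))
    (l'.+1 * (n * p) - \rank (@symmx R l' p))
    (@tvec R n p l'.+1 @` @tstiefel R n p l'.+1).
Proof.
move=> pn; split; first exact: leq_subr.
move=> x0 /image_tstiefelP oX.
set N := (l'.+1 * (n * p))%N in x0 oX *.
have cX := vcirc_circulant x0.
have [X0 eX] : exists X0, X0 = vcirc x0 by exists (vcirc x0).
rewrite -eX in oX cX.
have [K rK kerK] := tangent_matrix cX oX.
have [P uP flatP] := flatten_kernel K.
(* [Z] undoes the straightening by [P] and the shear, leaving only the Cayley transform to invert.
   It is polynomial on the whole space, which makes [V] open. *)
pose Z (v : 'rV[R]_N) := unshear X0 (vcirc (v *m invmx P)).
pose U := [set x : 'rV[R]_N | X0^T *m vcirc x + 1%:M \in unitmx].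
pose V := [set v : 'rV[R]_N | 1%:M - X0^T *m Z v \in unitmx].
pose phi (x : 'rV[R]_N) : 'rV[R]_N := unvcirc (shear X0 (stereo X0 (vcirc x))) *m P.
pose psi (v : 'rV[R]_N) : 'rV[R]_N := unvcirc (stereo_inv X0 (Z v)).
have rvc W : ratmx W (fun x : 'rV[R]_N => vcirc x) by apply: vcirc_rat; exact: ratmx_id.
have rZ W : ratmx W Z.
  by apply/unshear_rat/vcirc_rat; apply: ratmxM; [exact: ratmx_id|exact: ratmx_cst].
have oU : open U by apply: open_unitmx; exact: stereo_den_rat.
have oV : open V by apply: open_unitmx; exact: stereo_inv_den_rat.
have cZ v : circulant (Z v) by apply: circulant_unshear => //; exact: vcirc_circulant.
have Zphi x : U x -> Z (phi x) = stereo X0 (vcirc x).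
  move=> Ux; rewrite /Z /phi mulmxK// unvcircK ?shearK//.
  by apply: circulant_shear => //; apply: circulant_stereo => //; exact: vcirc_circulant.
have vpsi v : V v -> vcirc (psi v) = stereo_inv X0 (Z v).
  by move=> Vv; rewrite /psi unvcircK//; exact: circulant_stereo_inv.
have Vphi x : U x -> V (phi x).
  by move=> Ux; rewrite /V /= Zphi//; have [] := stereo_unit oX Ux.
have Upsi v : V v -> U (psi v).
  by move=> Vv; rewrite /U /= vpsi//; have [] := stereo_inv_unit oX Vv.
have phiK x : U x -> psi (phi x) = x.
  by move=> Ux; rewrite /psi Zphi// stereoK// vcircK.
have psiK v : V v -> phi (psi v) = v.
  move=> Vv; rewrite /phi vpsi// stereo_invK// /Z unshearK// vcircK.
  by rewrite mulmxKV.
(* The constraint becomes the linear tangent equation, then membership in the kernel of [K], then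
   vanishing of the last coordinates. *)
have Sphi x : U x -> (vcirc x)^T *m vcirc x = 1%:M <->
    flat_slice (N - \rank (@symmx R l' p)) (phi x).
  move=> Ux; apply: (iff_trans (stiefel_shear_stereo oX Ux)); rewrite -rK.
  apply: (iff_trans _ (flatP _)); apply: (iff_trans _ (iff_sym (kerK _))).
  rewrite unvcircK//; apply: circulant_shear => //; apply: circulant_stereo => //.
  exact: vcirc_circulant.
exists U, V, phi, psi; split; split => //.
(* At the base point the denominator is twice the identity. *)
- rewrite /U /= -eX oX.
  by rewrite -mulr2n -scaler_nat unitmxZ ?unitmx1// unitfE pnatr_eq0.
- apply: ratmx_smooth => //; apply: ratmxM; last exact: ratmx_cst.
  by apply/unvcirc_rat/shear_rat/stereo_rat.
- apply: ratmx_smooth => //.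
  by apply/unvcirc_rat/stereo_inv_rat.
- apply/seteqP; split=> [_ [x Ux <-]|v Vv]; first exact: Vphi.
  by exists (psi v); [exact: Upsi|exact: psiK].
- apply/seteqP; split=> [_ [x [Ux /image_tstiefelP sx] <-]|v [Vv fv]].
    by split; [exact: Vphi|exact/Sphi].
  exists (psi v); last exact: psiK.
  split; first exact: Upsi.
  by apply/image_tstiefelP/Sphi; [exact: Upsi|rewrite psiK].
Qed.

Theorem mainTheorem1 (R : realType) (n p l : nat) (hnp : (p <= n)%N) (hl : (1 <= l)%N) :
  exists d : nat,
    @embedded_submanifold R (l * (n * p)) d (@tvec R n p l @` @tstiefel R n p l) /\
    (d%:R : R) = p%:R * (n%:R * l%:R - p%:R * l%:R / 2
                         - 1 / (2 `^ `|sin (l%:R * pi / 2)|)).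
Proof.
case: l hl => // l' _.
exists (l'.+1 * (n * p) - \rank (@symmx R l' p))%N; split.
  exact: tstiefel_submanifold.
(* The bound [p <= n] makes the truncated subtraction of natural numbers a true one. *)
have rle : (\rank (@symmx R l' p) <= l'.+1 * (n * p))%N.
  by apply: leq_trans (rank_leq_row _) _; rewrite leq_mul2l leq_mul2r hnp orbT.
rewrite natrB// rank_symmx trace_symmx one_div_powR_sin !natrM.
by case: ifP => _; field.
Qed.
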